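(* Let $1\le t\le n$ and let $G$ be a finite directed acyclic graph with $t$ inputs, one of which is a distinguished input $s$, and $n$ outputs, such that $G$ is a $(t,n)$-concentrator and the graph obtained from $G$ by removing $s$ is a $(t-1,n)$-concentrator. For a finite field $\mathbb{F}_q$, convert $G$ into an arithmetic circuit over $\mathbb{F}_q$ by replacing each non-input vertex with a weighted addition gate, where the coefficients (one for each edge of $G$) are chosen independently and uniformly at random from $\mathbb{F}_q$. If $q$ is sufficiently large, then with high probability the resulting circuit computes the $n$ shares of a $(t,n)$-threshold secret sharing scheme (with the secret placed at input $s$ and uniformly random field elements at the other $t-1$ inputs). That is: for every $\eta>0$ there is $q_0$ (depending on $G$ and $\eta$) such that for every prime power $q\ge q_0$ this holds with probability at least $1-\eta$ over the choice of the coefficients.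
   Context: $(t,n)$-concentrator ($t\le n$): a directed acyclic graph with $t$ inputs and $n$ outputs in which for every set $T$ of $t$ outputs there are $t$ pairwise vertex-disjoint directed paths connecting $t$ distinct inputs to the vertices of $T$. Input vertices have no incoming edges. Weighted addition gate: a gate with in-coming values $x_1,\dots,x_m$ that outputs $\sum_{i=1}^m c_i x_i$, where $c_1,\dots,c_m$ are fixed coefficients attached to the incoming edges. Computing the shares of a $(t,n)$-threshold secret sharing scheme: let $S$ (the value at input $s$) be a random element uniform over $\mathbb{F}_q$, let the values at the other $t-1$ inputs be uniform over $\mathbb{F}_q$, with all inputs mutually independent, and let $Y_1,\dots,Y_n$ be the values of the $n$ outputs (the shares). For $T\subseteq[n]$ let $Y_T=(Y_i)_{i\in T}$. It is required that $H(S\mid Y_T)=0$ for every $T\subseteq[n]$ with $|T|=t$ (correctness) and $H(S\mid Y_T)=H(S)$ for every $T\subseteq[n]$ with $|T|=t-1$ (privacy), where $H$ is Shannon entropy. *)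

(* Defs.v *)
From mathcomp Require Import all_boot all_order all_algebra.
From mathcomp Require Import reals exp.

Set Implicit Arguments.
Unset Strict Implicit.
Unset Printing Implicit Defensive.

Import Order.TTheory GRing.Theory Num.Theory.
Local Open Scope ring_scope.

Record network := Network {
  vertex :> finType;
  edge : rel vertex;
  inputs : {set vertex};
  outputs : {set vertex} }.

Arguments edge : clear implicits.
Arguments inputs : clear implicits.
Arguments outputs : clear implicits.

Definition acyclic (G : network) : Prop :=
  forall c : seq G, cycle (edge G) c -> c = [::].

(* Pairwise vertex-disjoint directed paths, one for each v in T: the path for v
   visits start v :: rest v in this order, starts at an input and ends at v.
   A path may have length zero (when v is itself an input). *)
Definition linked_from_inputs (G : network) (T : {set G}) : Prop :=
  exists (start : G -> G) (rest : G -> seq G),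
    [/\ {in T, forall v, start v \in inputs G},
        {in T &, injective start},
        {in T, forall v, path (edge G) (start v) (rest v)},
        {in T, forall v, last (start v) (rest v) = v} &
        {in T &, forall v w, v != w ->
           [disjoint start v :: rest v & start w :: rest w]}].

Definition concentrator (t n : nat) (G : network) : Prop :=
  [/\ acyclic G,
      forall u v : G, v \in inputs G -> ~~ edge G u v,
      #|inputs G| = t,
      #|outputs G| = n &
      forall T : {set G}, T \subset outputs G -> #|T| = t ->
        linked_from_inputs T].

Definition remove_vertex (G : network) (s : G) : network :=
  @Network {v : G | v != s} (fun u v => edge G (val u) (val v))
    [set v | val v \in inputs G] [set v | val v \in outputs G].

Notation input_of G := {v : vertex G | v \in inputs G}.
Notation edge_of G := {uv : vertex G * vertex G | edge G uv.1 uv.2}.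

Section Circuit.
Variables (G : network) (F : finFieldType).
Variables (c : {ffun edge_of G -> F}) (x : {ffun input_of G -> F}).

Definition gate (f : G -> F) (v : G) : F :=
  if insub v is Some i then x i
  else \sum_(uv : edge_of G | (val uv).2 == v) c uv * f (val uv).1.

(* Synchronous evaluation: after #|G| rounds every vertex of an acyclic network
   has its final value, see circuit_valueE. *)
Definition circuit_value : G -> F := iter #|G| gate (fun=> 0).

Lemma acyclic_path_uniq (u : G) p :
  acyclic G -> path (edge G) u p -> uniq (u :: p).
Proof.
move=> acG; elim: p u => [//|v p IHp] u /[dup] uvp /andP[_ vp].
rewrite cons_uniq IHp // andbT; apply/negP => u_vp.
case/splitPr: u_vp uvp => p1 p2; rewrite cat_path /= => /and3P[up1 lu _].
suff: u :: p1 = [::] by [].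
by apply: acG; rewrite /= rcons_path up1.
Qed.

Lemma gate_local (f g : G -> F) (v : G) :
  (forall uv : edge_of G, (val uv).2 = v -> f (val uv).1 = g (val uv).1) ->
  gate f v = gate g v.
Proof.
move=> fg; rewrite /gate; case: insub => //.
by apply: eq_bigr => uv /eqP/fg ->.
Qed.

Lemma iter_gate_stable k (v : G) :
  (forall u p, path (edge G) u p -> last u p = v -> (size p < k)%N) ->
  iter k.+1 gate (fun=> 0) v = iter k gate (fun=> 0) v.
Proof.
elim: k v => [|k IHk] v short; first by have := short v [::] isT erefl.
apply: (gate_local (f := iter k.+1 gate (fun=> 0))) => uv uvv.
apply: IHk => w p wp wpu.
have := short w (rcons p v); rewrite size_rcons last_rcons; apply => //.
by rewrite rcons_path wp wpu -uvv (valP uv).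
Qed.

Lemma circuit_valueE (v : G) :
  acyclic G -> circuit_value v = gate circuit_value v.
Proof.
move=> acG; symmetry; apply: iter_gate_stable => u p up _.
have /card_uniqP/= <- := acyclic_path_uniq acG up.
exact: max_card.
Qed.

End Circuit.

(* Finite probability: P is the mass function of a law on Omega. *)
Section Entropy.
Variables (R : realType) (Omega : finType) (P : Omega -> R).

Definition pr (E : pred Omega) : R := \sum_(w | E w) P w.

Definition log2 (a : R) : R := ln a / ln 2.

Definition entropy (A : finType) (X : Omega -> A) : R :=
  - \sum_(a : A) pr [pred w | X w == a] * log2 (pr [pred w | X w == a]).

(* Meaningful only when pr B != 0. *)
Definition cond_pr (E B : pred Omega) : R := pr [predI E & B] / pr B.

(* The values b of probability zero contribute 0. *)
Definition cond_entropy (A B : finType) (X : Omega -> A) (Y : Omega -> B) : R :=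
  \sum_(b : B) pr [pred w | Y w == b] *
    - \sum_(a : A) cond_pr [pred w | X w == a] [pred w | Y w == b] *
        log2 (cond_pr [pred w | X w == a] [pred w | Y w == b]).

Definition restrict (I B : finType) (T : {set I}) (Y : I -> Omega -> B)
    (w : Omega) : {ffun {i : I | i \in T} -> B} :=
  [ffun i => Y (val i) w].

(* Secret S; the parties are the elements of J and party j gets the share Y j. *)
Definition threshold_scheme (t : nat) (A B I : finType) (S : Omega -> A)
    (J : {set I}) (Y : I -> Omega -> B) : bool :=
  [forall T : {set I}, (T \subset J) ==>
     ((#|T| == t) ==> (cond_entropy S (restrict T Y) == 0)) &&
     ((#|T| == t.-1) ==> (cond_entropy S (restrict T Y) == entropy S))].

End Entropy.

(* The joint law of independent uniform elements of F indexed by I. *)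
Definition iid_uniform (R : realType) (I F : finType) (f : {ffun I -> F}) : R :=
  \prod_(i : I) (#|F|%:R)^-1.

(* For fixed coefficients c, with the input values random. *)
Definition computes_threshold_scheme (R : realType) (t : nat) (G : network)
    (s : input_of G) (F : finFieldType) (c : {ffun edge_of G -> F}) : bool :=
  threshold_scheme (@iid_uniform R (input_of G) F) t (fun x => x s)
    (outputs G) (fun v x => circuit_value c x v).

(* Main.v *)
Require Import Defs.
From mathcomp Require Import all_boot all_order all_algebra.
From mathcomp Require Import reals exp.
From mathcomp Require Import perm.

Set Implicit Arguments.
Unset Strict Implicit.
Unset Printing Implicit Defensive.

Import Order.TTheory GRing.Theory Num.Theory.
Local Open Scope ring_scope.

(* Call a set U of t vertices good when the t values on U determine the t inputs.
   If U is linked from the inputs, the determinant of the transfer matrix to U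
   is a polynomial in the coefficients which equals 1 for the coefficients that
   route the inputs along the linking paths; hence it rarely vanishes over a
   large field, and a union bound makes all the relevant U good at once.
   Goodness of a set T of t outputs is correctness for T. Since s is itself a
   vertex, carrying the secret, privacy for a set T of t - 1 outputs is goodness
   of T together with s, and paths linking T in G minus s extend by the trivial
   path at s. *)

(** * Univariate functions of bounded polynomial degree *)

(** Asking only for agreement with some polynomial avoids formal polynomials in all the
    coefficients. The degree bound is [d], since [size] is the degree plus one. *)
Definition poly_fun {F : comNzRingType} (d : nat) (g : F -> F) :=
  exists2 p : {poly F}, (size p <= d.+1)%N & g =1 horner p.

Section PolyFun.
Variable F : comNzRingType.

Lemma poly_fun_ext d (g h : F -> F) : g =1 h -> poly_fun d g -> poly_fun d h.
Proof. by move=> gh [p sp gp]; exists p => // a; rewrite -gh gp. Qed.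

Lemma poly_fun_affine (b c : F) : poly_fun 1 (fun a => b + a * c).
Proof.
exists (b%:P + 'X * c%:P) => [|a]; last by rewrite !hornerE.
rewrite (leq_trans (size_polyD _ _)) // geq_max (leq_trans (size_polyC_leq1 _)) //=.
rewrite (leq_trans (size_polyMleq _ _)) // size_polyX.
by have := size_polyC_leq1 c; case: size => [|[]].
Qed.

Lemma poly_fun_cst d (b : F) : poly_fun d (fun=> b).
Proof.
exists b%:P => [|a]; last by rewrite hornerC.
exact: leq_trans (size_polyC_leq1 _) _.
Qed.

Lemma poly_funM d e (g h : F -> F) :
  poly_fun d g -> poly_fun e h -> poly_fun (d + e) (fun a => g a * h a).
Proof.
move=> [p sp gp] [q sq hq]; exists (p * q) => [|a]; last first.
  by rewrite hornerM gp hq.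
rewrite (leq_trans (size_polyMleq _ _)) //.
by rewrite -subn1 leq_subLR (leq_trans (leq_add sp sq)) // addSn addnS.
Qed.

Lemma poly_fun_sum d (I : Type) (r : seq I) (P : pred I) (g : I -> F -> F) :
  (forall i, poly_fun d (g i)) -> poly_fun d (fun a => \sum_(i <- r | P i) g i a).
Proof.
move=> gP; elim: r => [|i r IHr].
  by apply: poly_fun_ext (poly_fun_cst d 0) => a; rewrite big_nil.
case: IHr (gP i) => [p sp hp] [q sq gq].
exists (if P i then q + p else p) => [|a].
  by case: ifP => // _; rewrite (leq_trans (size_polyD _ _)) // geq_max sq.
by rewrite big_cons; case: ifP => _; rewrite ?hornerD hp ?gq.
Qed.

Lemma poly_fun_prod d (I : Type) (r : seq I) (g : I -> F -> F) :
  (forall i, poly_fun d (g i)) ->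
  poly_fun (d * size r) (fun a => \prod_(i <- r) g i a).
Proof.
move=> gP; elim: r => [|i r IHr].
  by apply: poly_fun_ext (poly_fun_cst _ 1) => a; rewrite big_nil.
apply: (@poly_fun_ext _ (fun a => g i a * \prod_(j <- r) g j a)) => [a|].
  by rewrite big_cons.
by rewrite /= mulnS; apply: poly_funM.
Qed.

(** In the Leibniz expansion each term is a sign times a product of [m] entries. *)
Lemma poly_fun_det d m (M : F -> 'M[F]_m) :
  (forall i j, poly_fun d (fun a => M a i j)) ->
  poly_fun (d * m) (fun a => \det (M a)).
Proof.
move=> MP; apply: poly_fun_sum => s; rewrite -[(d * m)%N]add0n.
apply: poly_funM; first exact: poly_fun_cst.
have := poly_fun_prod (index_enum 'I_m) (fun i => MP i (s i)).
by have -> : size (index_enum 'I_m) = m by rewrite [index_enum _]unlock -enumT size_enum_ord.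
Qed.

End PolyFun.

(** * Counting zeros along lines *)

Definition line {I : finType} {F : pzRingType} (c0 u : {ffun I -> F}) (a : F) :
  {ffun I -> F} := [ffun i => c0 i + a * u i].

Lemma line_inj (I : finType) (F : fieldType) (c0 : {ffun I -> F}) (a : F) :
  a != 0 -> injective (fun u => line c0 u a).
Proof.
move=> a0 u v /ffunP uv; apply/ffunP => i.
by have := uv i; rewrite !ffunE => /addrI/(mulfI a0).
Qed.

Lemma card_roots_poly_fun (F : finFieldType) d (g : F -> F) :
  poly_fun d g -> g 0 != 0 -> (#|[set a | g a == 0%R]| <= d)%N.
Proof.
move=> [p sp gp] g0; rewrite -ltnS (leq_trans _ sp) // cardE.
apply: max_poly_roots; rewrite ?enum_uniq //.
  by apply: contraNneq g0 => p0; rewrite gp p0 horner0.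
by apply/allP => a; rewrite mem_enum inE gp.
Qed.

(* A Schwartz-Zippel bound, by averaging over the lines through [c0]: each of
   them carries at most [d] zeros, and for fixed [a != 0] the point [c0 + a u]
   is uniform when the direction [u] is. *)
Lemma card_zeros_line (I : finType) (F : finFieldType) d
    (h : {ffun I -> F} -> F) (c0 : {ffun I -> F}) :
  h c0 != 0 -> (forall u, poly_fun d (fun a => h (line c0 u a))) ->
  (#|[set c | h c == 0%R]| * #|F|.-1 <= d * #|F| ^ #|I|)%N.
Proof.
move=> h0 hP.
have card_line a : a != 0 ->
    #|[set c | h c == 0%R]| = #|[set u | h (line c0 u a) == 0%R]|.
  move=> a0; rewrite -(card_preimset _ (line_inj (c0 := c0) a0)).
  by apply: eq_card => u; rewrite !inE.
(* Pairs [(a, u)] with [a != 0] and [h] zero at [line c0 u a] are counted first by [a], then by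
   [u]. *)
have -> : (#|[set c | h c == 0%R]| * #|F|.-1 =
    \sum_(a in [set~ 0%R]) #|[set u | h (line c0 u a) == 0%R]|)%N.
  rewrite -(cardsC1 (0 : F)) mulnC -sum_nat_const; apply: eq_bigr => a.
  by rewrite !inE; apply: card_line.
rewrite -card_ffun mulnC -sum_nat_const.
under eq_bigr => a _ do rewrite -sum1_card big_mkcond.
rewrite exchange_big; apply: leq_sum => u _.
rewrite -big_mkcondr sum1_card /=.
(* At [a = 0] the line passes through [c0], so the polynomial along it is nonzero. *)
apply: leq_trans (card_roots_poly_fun (hP u) _); last first.
  by rewrite (_ : line c0 u 0 = c0) //; apply/ffunP => i; rewrite ffunE mul0r addr0.
apply/subset_leq_card/subsetP => a /andP[_]; rewrite !inE => au.
by have : a \in [set b | h (line c0 u b) == 0] by rewrite inE.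
Qed.

(** * Linearity and degree of circuit values *)

Section CircuitAlgebra.
Variables (G : network) (F : finFieldType).
Implicit Types (c : {ffun edge_of G -> F}) (x : {ffun input_of G -> F}).

Definition unit_input (j : input_of G) : {ffun input_of G -> F} :=
  [ffun i => (i == j)%:R].

Lemma circuit_value_input c x (i : input_of G) : acyclic G ->
  circuit_value c x (val i) = x i.
Proof. by move=> acG; rewrite circuit_valueE // /gate valK. Qed.

(** Every evaluation round preserves linearity in the inputs, hence the induction on the number of
    rounds. *)
Lemma circuit_value_sum c x v :
  circuit_value c x v = \sum_j x j * circuit_value c (unit_input j) v.
Proof.
rewrite /circuit_value; elim: #|G| v => [|k IHk] v /=.
  by rewrite big1 // => j _; rewrite mulr0.
rewrite {1}/gate; case iv: (insub v : option (input_of G)) => [i|].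
  rewrite (bigD1 i) //= big1 => [|j ji]; rewrite /gate iv ffunE.
    by rewrite eqxx mulr1 addr0.
  by rewrite eq_sym (negPf ji) mulr0.
under [RHS]eq_bigr => j _ do rewrite /gate iv mulr_sumr.
rewrite exchange_big; apply: eq_bigr => uv _ /=.
by rewrite IHk mulr_sumr; apply: eq_bigr => j _; rewrite mulrCA.
Qed.

Lemma circuit_value_line c x z a v :
  circuit_value c (line x z a) v =
  circuit_value c x v + a * circuit_value c z v.
Proof.
rewrite circuit_value_sum [circuit_value c x v]circuit_value_sum.
rewrite [circuit_value c z v]circuit_value_sum mulr_sumr -big_split.
by apply: eq_bigr => j _ /=; rewrite ffunE mulrDl mulrA.
Qed.

(** Each round multiplies by coefficients that are affine along the line, which raises the degree
    bound by one. *)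
Lemma circuit_value_poly_fun c u x v :
  poly_fun #|G| (fun a => circuit_value (line c u a) x v).
Proof.
rewrite /circuit_value; elim: #|G| v => [|k IHk] v; first exact: poly_fun_cst.
rewrite /= /gate; case: insub => [i|]; first exact: poly_fun_cst.
apply: poly_fun_sum => uv; rewrite -add1n; apply: poly_funM (IHk _).
apply: (@poly_fun_ext _ _ (fun a => c uv + a * u uv)) => [a|].
  by rewrite ffunE.
exact: poly_fun_affine.
Qed.

(** Columns are the responses to unit inputs; indexing the observed vertices by the inputs makes the
    matrix square. *)
Definition transfer_mx (o : input_of G -> G) c : 'M[F]_#|{: input_of G}| :=
  \matrix_(i, j) circuit_value c (unit_input (enum_val j)) (o (enum_val i)).

Lemma transfer_mx_inj o c x y : \det (transfer_mx o c) != 0 ->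
  (forall i, circuit_value c x (o i) = circuit_value c y (o i)) -> x = y.
Proof.
rewrite -unitfE -unitmxE => Mu xy.
pose col (z : {ffun input_of G -> F}) : 'cV[F]_#|{: input_of G}| := \col_j z (enum_val j).
have colE z : transfer_mx o c *m col z =
    \col_i circuit_value c z (o (enum_val i)).
  apply/colP => i; rewrite !mxE circuit_value_sum.
  rewrite [RHS](big_enum_val (A := {: input_of G})).
  by apply: eq_bigr => j _; rewrite !mxE mulrC.
have : col x = col y.
  rewrite -[LHS](mulKmx Mu) -[RHS](mulKmx Mu) !colE; congr (_ *m _).
  by apply/colP => i; rewrite !mxE xy.
move=> /colP cxy; apply/ffunP => i.
by have := cxy (enum_rank i); rewrite !mxE enum_rankK.
Qed.

(** At [c0] the transfer matrix is the identity, so its determinant is a nonzero function of degree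
    at most [#|G|] per row. *)
Lemma card_singular_transfer o c0 :
  (forall x i, circuit_value c0 x (o i) = x i) ->
  (#|[set c | \det (transfer_mx o c) == 0%R]| * #|F|.-1 <=
     #|G| * #|{: input_of G}| * #|F| ^ #|{: edge_of G}|)%N.
Proof.
move=> c0P; apply: (@card_zeros_line _ _ _ _ c0) => [|u].
  rewrite (_ : transfer_mx o c0 = 1%:M) ?det1 ?oner_eq0 //.
  by apply/matrixP => i j; rewrite !mxE c0P ffunE (inj_eq enum_val_inj).
apply: poly_fun_det => i j.
apply: poly_fun_ext (circuit_value_poly_fun c0 u _ _) => a.
by rewrite mxE.
Qed.

End CircuitAlgebra.

(** * Routing inputs along disjoint paths *)

(* Coefficients 1 along the paths and 0 elsewhere make the circuit copy each
   input to the end of its path. *)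
Lemma linked_routing (G : network) (F : finFieldType) (U : {set G}) :
  acyclic G -> (forall u v : G, v \in inputs G -> ~~ edge G u v) ->
  linked_from_inputs U -> #|U| = #|inputs G| ->
  exists (o : input_of G -> G) (c0 : {ffun edge_of G -> F}),
    (forall i, o i \in U) /\ (forall x i, circuit_value c0 x (o i) = x i).
Proof.
move=> acG inG [start [rest [st_in st_inj st_path st_last st_disj]]] cardU.
(* The starts are distinct and as many as the inputs, so every input starts a path. *)
have startU : start @: U = inputs G.
  apply/eqP; rewrite eqEcard card_in_imset // cardU leqnn andbT.
  by apply/subsetP => _ /imsetP[v vU ->]; apply: st_in.
have /fin_all_exists2[o oU oE] (i : input_of G) :
    exists2 v, v \in U & start v = val i.
  have : val i \in start @: U by rewrite startU; exact: (valP i).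
  by case/imsetP => v vU ->; exists v.
(* The predecessor of [w] on the path to [v]: prepending [start v] shifts positions by one. *)
pose prv v w := nth (start v) (start v :: rest v) (index w (rest v)).
pose c0 : {ffun edge_of G -> F} := [ffun uv =>
  [exists v in U, ((val uv).2 \in rest v) &&
                  ((val uv).1 == prv v (val uv).2)]%:R].
exists o, c0; split=> // x i.
set v := o i; have vU : v \in U by exact: oU.
have vuniq := acyclic_path_uniq acG (st_path v vU).
suff along k : (k <= size (rest v))%N ->
    circuit_value c0 x (nth (start v) (start v :: rest v) k) = x i.
  by rewrite -{1}(st_last v vU) (last_nth (start v)) along.
elim: k => [_|k IHk lt_k]; first by rewrite /= oE circuit_value_input.
set w := nth _ _ _; have w_rest : w \in rest v by exact: (mem_nth (start v) lt_k).
have prv_w : prv v w = nth (start v) (start v :: rest v) k.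
  by rewrite /prv -[w]/(nth (start v) (rest v) k) index_uniq //; case/andP: vuniq.
have ew : edge G (prv v w) w.
  by rewrite prv_w; have /(pathP (start v))/(_ k lt_k) := st_path v vU.
rewrite circuit_valueE // /gate insubF; last first.
  by apply: contraTF ew; apply: inG.
pose e0 : edge_of G := Sub (prv v w, w) ew.
(* An edge into [w] with coefficient 1 comes from a path through [w]; by disjointness this is the
   path to [v], so the edge is [e0]. *)
rewrite (bigD1 e0) ?eqxx //= big1 => [|uv /andP[/eqP uvw ne]].
  rewrite ffunE addr0 (_ : [exists _ in _, _]) ?mul1r ?prv_w ?IHk 1?ltnW //.
  by apply/existsP; exists v; rewrite vU /= w_rest eqxx.
rewrite ffunE; case: existsP => [|_]; last by rewrite mul0r.
move=> [v' /and3P[v'U]]; rewrite uvw => w_rest' /eqP uv1.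
have v'v : v' = v.
  apply/eqP/negPn/negP => /(st_disj v' v v'U vU).
  by rewrite disjoint_has => /hasP[]; exists w; rewrite inE ?w_rest ?w_rest' orbT.
by case/eqP: ne; apply/val_inj; rewrite [LHS]surjective_pairing uvw uv1 v'v.
Qed.

Lemma card_inputs (G : network) : #|{: input_of G}| = #|inputs G|.
Proof. by rewrite card_sig; apply: eq_card. Qed.

Definition determines (G : network) (F : finFieldType) (U : {set G})
    (c : {ffun edge_of G -> F}) :=
  injectiveb (fun x => restrict U (fun v x => circuit_value c x v) x).

(** A nonsingular transfer matrix recovers the inputs from values on [U], so the exceptional
    coefficients are among the zeros of the determinant. *)
Lemma card_not_determines (G : network) (F : finFieldType) (U : {set G}) :
  acyclic G -> (forall u v : G, v \in inputs G -> ~~ edge G u v) ->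
  linked_from_inputs U -> #|U| = #|inputs G| ->
  (#|[set c : {ffun edge_of G -> F} | ~~ determines U c]| * #|F|.-1 <=
     #|G| * #|inputs G| * #|F| ^ #|{: edge_of G}|)%N.
Proof.
move=> acG inG lU cU; have [o [c0 [oU c0P]]] := @linked_routing G F U acG inG lU cU.
rewrite -card_inputs; apply: leq_trans (card_singular_transfer c0P).
rewrite leq_mul2r subset_leq_card ?orbT //; apply/subsetP => c; rewrite !inE.
apply: contraR => det_c; apply/injectiveP => x y xy.
apply: (transfer_mx_inj det_c) => i.
by have /ffunP/(_ (Sub (o i) (oU i))) := xy; rewrite !ffunE.
Qed.

(** * Entropy under determinacy and independence *)

Section EntropyFacts.
Variables (R : realType) (Omega : finType) (P : Omega -> R).

(** Given a value of [Y] of nonzero mass, [S] is constant, and the terms [1 * log2 1] and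
    [0 * log2 0] both vanish. *)
Lemma cond_entropy_eq0 (A B : finType) (S : Omega -> A) (Y : Omega -> B) :
  (forall w w', Y w = Y w' -> S w = S w') -> cond_entropy P S Y = 0.
Proof.
move=> YS; apply: big1 => b _.
case: (pickP [pred w | Y w == b]) => [w0 /= /eqP Yw0|Yb]; last first.
  by rewrite {1}/pr big_pred0 ?mul0r.
case: (eqVneq (pr P [pred w | Y w == b]) 0) => [->|pb0]; first by rewrite mul0r.
rewrite big1 ?oppr0 ?mulr0 // => a _; rewrite /cond_pr.
case: (eqVneq a (S w0)) => [->|aS].
  rewrite (_ : pr P [predI _ & _] = pr P [pred w | Y w == b]).
    by rewrite divff // /log2 ln1 mul0r mulr0.
  apply: eq_bigl => w /=; apply: andb_idl => /eqP Yw.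
  by apply/eqP/YS; rewrite Yw Yw0.
rewrite (_ : pr P [predI _ & _] = 0) ?mul0r //.
apply: big_pred0 => w /=; apply: contraNF aS => /andP[/eqP <- /eqP Yw].
by apply/eqP/YS; rewrite Yw Yw0.
Qed.

Lemma pr_partition (B : finType) (Y : Omega -> B) (E : pred Omega) :
  pr P E = \sum_b pr P [predI E & [pred w | Y w == b]].
Proof. exact: (partition_big Y xpredT). Qed.

Lemma cond_entropy_indep (A B : finType) (S : Omega -> A) (Y : Omega -> B) :
  pr P predT = 1 ->
  (forall a b, pr P [predI [pred w | S w == a] & [pred w | Y w == b]] =
               pr P [pred w | S w == a] * pr P [pred w | Y w == b]) ->
  cond_entropy P S Y = entropy P S.
Proof.
move=> P1 SY; have := pr_partition Y predT; rewrite P1 => sumY.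
(* The entropy of [S] is written as an average of itself, weighted by the law of [Y]. *)
rewrite -[RHS]mul1r {1}sumY mulr_suml; apply: eq_bigr => b _.
rewrite (_ : pr P [predI predT & _] = pr P [pred w | Y w == b]) //.
case: (eqVneq (pr P [pred w | Y w == b]) 0) => [->|pb0]; first by rewrite !mul0r.
congr (_ * - _); apply: eq_bigr => a _.
by rewrite /cond_pr SY mulfK.
Qed.

(** The maps [f d] preserve [P] and [Y] and carry any value of [S] to any other, so the joint
    probability does not depend on [a]: [S] is uniform and independent of [Y]. *)
Lemma indep_of_shift (F : finZmodType) (B : finType) (S : Omega -> F)
    (Y : Omega -> B) (f : F -> Omega -> Omega) :
  pr P predT = 1 -> (forall d, injective (f d)) ->
  (forall d w, P (f d w) = P w) -> (forall d w, S (f d w) = S w + d) ->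
  (forall d w, Y (f d w) = Y w) ->
  forall a b, pr P [predI [pred w | S w == a] & [pred w | Y w == b]] =
              pr P [pred w | S w == a] * pr P [pred w | Y w == b].
Proof.
move=> P1 f_inj fP fS fY.
have shift a b : pr P [predI [pred w | S w == a] & [pred w | Y w == b]] =
                 pr P [predI [pred w | S w == 0] & [pred w | Y w == b]].
  rewrite /pr (reindex_inj (f_inj a)); apply: eq_big => [w|w _] /=.
    by rewrite !inE fS fY -subr_eq0 addrK.
  exact: fP.
have Yb b : pr P [pred w | Y w == b] =
    #|F|%:R * pr P [predI [pred w | S w == 0] & [pred w | Y w == b]].
  rewrite (pr_partition S) mulr_natl -sumr_const; apply: eq_bigr => a _.
  by rewrite -(shift a); apply: eq_bigl => w; rewrite /= andbC.
have Sa a : pr P [pred w | S w == a] * #|F|%:R = 1.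
  rewrite -[RHS]P1 [LHS]mulrC 2!(pr_partition Y) mulr_sumr.
  by apply: eq_bigr => b _; rewrite shift -Yb.
by move=> a b; rewrite shift Yb mulrA Sa mul1r.
Qed.

End EntropyFacts.

(** * Uniform laws, correctness and privacy *)

Lemma pr_iid_uniform (R : realType) (I F : finType) (E : pred {ffun I -> F}) :
  pr (@iid_uniform R I F) E = #|E|%:R / (#|F| ^ #|I|)%:R.
Proof.
rewrite /pr /iid_uniform sumr_const prodr_const.
by rewrite natrX exprVn mulr_natl.
Qed.

Lemma pr_iid_uniform_setT (R : realType) (I : finType) (F : finFieldType) :
  pr (@iid_uniform R I F) predT = 1.
Proof.
rewrite pr_iid_uniform card_ffun divff // pnatr_eq0 -lt0n expn_gt0.
by apply/orP; left; apply/card_gt0P; exists 0.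
Qed.

Section Scheme.
Variables (R : realType) (G : network) (s : input_of G) (F : finFieldType).
Variable c : {ffun edge_of G -> F}.

Lemma correctness_of_determines (T : {set G}) : determines T c ->
  cond_entropy (@iid_uniform R (input_of G) F) (fun x => x s)
    (restrict T (fun v x => circuit_value c x v)) = 0.
Proof. by move=> /injectiveP T_inj; apply: cond_entropy_eq0 => x y /T_inj->. Qed.

(* Since [s] together with [T] determines the inputs, some input vector [z] has
   [z s = 1] and value 0 on [T]; translations along [z] change the secret but
   not the shares. *)
Lemma privacy_of_determines (T : {set G}) : acyclic G ->
  val s \notin T -> #|val s |: T| = #|inputs G| -> determines (val s |: T) c ->
  cond_entropy (@iid_uniform R (input_of G) F) (fun x => x s)
    (restrict T (fun v x => circuit_value c x v)) =
  entropy (@iid_uniform R (input_of G) F) (fun x => x s).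
Proof.
move=> acG sT cardU /injectiveP U_inj.
(* Source and target have equal size, so injectivity yields a preimage [z] of the indicator of
   [s]. *)
have U_bij : bijective
    (restrict (val s |: T) (fun v x => circuit_value c x v)).
  apply: inj_card_bij U_inj _.
  by rewrite !card_ffun card_inputs -cardU card_sig leqnn.
case: U_bij => g _ /(_ [ffun v => (val v == val s)%:R])/ffunP.
set z := g _ => zP.
have zs : z s = 1.
  have := zP (Sub (val s) (setU11 _ _)).
  by rewrite !ffunE /= circuit_value_input // eqxx.
have zT v : v \in T -> circuit_value c z v = 0.
  move=> vT; have := zP (Sub v (setU1r _ vT)).
  by rewrite !ffunE /= (_ : (v == val s) = false) //; apply: contraNF sT => /eqP vs; rewrite -vs.
apply: cond_entropy_indep; first exact: pr_iid_uniform_setT.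
apply: (@indep_of_shift _ _ _ _ _ _ _ (fun d x => line x z d)) => //.
- exact: pr_iid_uniform_setT.
- move=> d x y /ffunP xy; apply/ffunP => i.
  by have := xy i; rewrite !ffunE => /addIr.
- by move=> d x; rewrite ffunE zs mulr1.
- move=> d x; apply/ffunP => v.
  by rewrite !ffunE circuit_value_line zT ?mulr0 ?addr0 // (valP v).
Qed.

(** Deleting [s] from [U] in the hypothesis lets one family serve both requirements: [U = T] for
    correctness and [U = val s |: T] for privacy. *)
Lemma scheme_of_determines : acyclic G -> val s \notin outputs G ->
  (forall U : {set G}, U :\ val s \subset outputs G -> #|U| = #|inputs G| ->
     determines U c) ->
  computes_threshold_scheme R #|inputs G| s c.
Proof.
move=> acG sO det_c; apply/forallP => T; apply/implyP => TO.
have sT : val s \notin T by apply: contraNN sO; apply: (subsetP TO).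
have t_gt0 : (0 < #|inputs G|)%N by apply/card_gt0P; exists (val s); apply: valP s.
apply/andP; split; apply/implyP => /eqP cT; apply/eqP.
  apply: correctness_of_determines; apply: det_c => //.
  exact: subset_trans (subsetDl _ _) TO.
have cU : #|val s |: T| = #|inputs G| by rewrite cardsU1 sT cT add1n prednK.
by apply: privacy_of_determines => //; apply: det_c; rewrite ?setU1K.
Qed.

End Scheme.

(** * Removing the secret input *)

Section Removal.
Variables (G : network) (s : G).

(** Removing an output would lower the number of outputs. *)
Lemma notin_outputs_remove_vertex :
  #|outputs (remove_vertex s)| = #|outputs G| -> s \notin outputs G.
Proof.
move=> cO; apply/negP => sO; have := ltnn #|outputs G|.
rewrite {2}(cardsD1 s) sO add1n ltnS -{1}cO.
rewrite -(card_imset _ val_inj) subset_leq_card //.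
apply/subsetP => _ /imsetP[v vO ->]; rewrite !inE (valP v).
by move: vO; rewrite inE.
Qed.

(** Paths of the smaller graph, mapped into [G], avoid [s] and so are disjoint from the path of
    length zero there. *)
Lemma linked_setU1_remove_vertex (T : {set G}) : s \in inputs G -> s \notin T ->
  linked_from_inputs (G := remove_vertex s) [set v | val v \in T] ->
  linked_from_inputs (s |: T).
Proof.
move=> sI sT [start [rest [st_in st_inj st_path st_last st_disj]]].
(* [insub] fails exactly at [s], so the default branches describe the trivial path. *)
exists (fun v => if insub v is Some v' then val (start v') else s).
exists (fun v => if insub v is Some v' then map val (rest v') else [::]).
have inT v : v \in s |: T -> v != s ->
    exists2 v' : remove_vertex s, val v' = v & v' \in [set v | val v \in T].
  move=> + vs; rewrite !inE (negPf vs) /= => vT.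
  by exists (Sub v vs); rewrite ?inE SubK.
have insub_s : insub s = None :> option (remove_vertex s) by rewrite insubF ?eqxx.
have avoids (v : remove_vertex s) : s \notin val (start v) :: map val (rest v).
  rewrite -map_cons; apply/mapP => -[u _ us].
  by have := valP u; rewrite -us eqxx.
split.
- move=> v vU; case: (eqVneq v s) => [->|/(inT v vU)[v' <- vT]].
    by rewrite insub_s.
  by rewrite valK; have := st_in v' vT; rewrite inE.
- move=> v w vU wU; case: (eqVneq v s) => [->|/(inT v vU)[v' <- vT]];
    case: (eqVneq w s) => [->|/(inT w wU)[w' <- wT]]; rewrite ?insub_s ?valK //.
  + by move=> sw; have := valP (start w'); rewrite -sw eqxx.
  + by move=> vs; have := valP (start v'); rewrite vs eqxx.
  + by move=> /val_inj/st_inj ->.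
- move=> v vU; case: (eqVneq v s) => [->|/(inT v vU)[v' <- vT]].
    by rewrite insub_s.
  by rewrite valK path_map; apply: st_path.
- move=> v vU; case: (eqVneq v s) => [->|/(inT v vU)[v' <- vT]].
    by rewrite insub_s.
  by rewrite valK last_map st_last.
- move=> v w vU wU; case: (eqVneq v s) => [->|/(inT v vU)[v' <- vT]];
    case: (eqVneq w s) => [->|/(inT w wU)[w' <- wT]] vw;
    rewrite ?insub_s ?valK.
  + by [].
  + by rewrite disjoint_has /= orbF avoids.
  + by rewrite disjoint_sym disjoint_has /= orbF avoids.
  + rewrite -!map_cons disjoint_has; apply/hasPn => _ /mapP[u uv ->].
    rewrite mem_map; last exact: val_inj.
    have := st_disj v' w' vT wT; rewrite -(inj_eq val_inj) => /(_ vw).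
    by rewrite disjoint_has => /hasPn; apply.
Qed.

End Removal.

(** * Union bound over the relevant vertex sets *)

Theorem theorem2 (R : realType) (t n : nat) (G : network) (s : input_of G) :
  (1 <= t <= n)%N ->
  concentrator t n G ->
  concentrator t.-1 n (remove_vertex (val s)) ->
  forall eta : R, 0 < eta ->
  exists q0 : nat, forall F : finFieldType, (q0 <= #|F|)%N ->
    1 - eta <= pr (@iid_uniform R (edge_of G) F)
                  (fun c => computes_threshold_scheme R t s c).
Proof.
move=> _ [acG inG cI cO linkG] [_ _ _ cO' linkG'] eta eta_gt0; subst t.
have sO : val s \notin outputs G.
  by apply: notin_outputs_remove_vertex; rewrite cO cO'.
pose K := [pred U : {set G} |
  (U :\ val s \subset outputs G) && (#|U| == #|inputs G|)].
have linkK U : K U -> linked_from_inputs U.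
  move=> /andP[UO /eqP cU]; have [sU|sU] := boolP (val s \in U); last first.
    apply: linkG => //; apply: subset_trans UO.
    by rewrite subsetD1 sU subxx.
  rewrite -(setD1K sU).
  apply: linked_setU1_remove_vertex; rewrite ?setD11 //; first exact: (valP s).
  apply: linkG'.
    apply/subsetP => v; rewrite !inE => /andP[vs vU].
    by apply: (subsetP UO); rewrite !inE vs.
  rewrite -cU (cardsD1 (val s) U) sU /= -(card_imset _ val_inj).
  apply: eq_card => v; apply/imsetP/idP => [[u + ->]|]; first by rewrite inE.
  rewrite !inE => /andP[vs vU].
  by exists (Sub v vs); rewrite ?SubK // !inE SubK vs.
(* The relevant sets are crudely counted by all vertex sets; the other factor is the degree of the
   determinant. *)
pose N := (#|{set G}| * (#|G| * #|inputs G|))%N.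
(* The successor is there because the zero count divides by [#|F|.-1], which must exceed
   [N / eta]. *)
exists (Num.bound (N%:R / eta : R)).+1 => F qF.
pose bad := [set c : {ffun edge_of G -> F} |
  ~~ computes_threshold_scheme R #|inputs G| s c].
have bad_le : (#|bad| * #|F|.-1 <= N * #|F| ^ #|{: edge_of G}|)%N.
  pose bU U := [set c : {ffun edge_of G -> F} | ~~ determines U c].
  have : bad \subset \bigcup_(U | K U) bU U.
    apply/subsetP => c; rewrite inE => /negP badc; apply/bigcupP/exists_inP.
    apply: contra_notT badc => /exists_inPn detc.
    apply: scheme_of_determines => // U UO cU.
    by have := detc U; rewrite !inE UO cU eqxx negbK; apply.
  move=> /subset_leq_card/leq_trans le_bad.
  apply: (@leq_trans ((\sum_(U | K U) #|bU U|) * #|F|.-1)%N).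
    rewrite leq_mul2r le_bad ?orbT //.
    elim/big_ind2: _ => [|k A l B kA lB|//]; first by rewrite cards0.
    by rewrite (leq_trans (leq_card_setU _ _)) // leq_add.
  rewrite big_distrl /= /N -mulnA -sum_nat_const [leqRHS](bigID K) /=.
  apply: leq_trans (leq_addr _ _); apply: leq_sum => U KU.
  by apply: card_not_determines => //; [exact: linkK|case/andP: KU => _ /eqP].
have q1_gt : N%:R / eta < #|F|.-1%:R.
  apply: lt_le_trans (archi_boundP _) _; first by rewrite divr_ge0 // ltW.
  by rewrite ler_nat -ltnS (leq_trans qF) // leqSpred.
have q1_gt0 : (0 : R) < #|F|.-1%:R.
  by apply: le_lt_trans q1_gt; rewrite divr_ge0 // ltW.
rewrite pr_iid_uniform; set Q := (_ ^ _)%N in bad_le *.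
have Q_gt0 : (0 : R) < Q%:R.
  by rewrite ltr0n expn_gt0 (leq_trans _ qF).
rewrite ler_pdivlMr //.
have -> : #|fun c : {ffun edge_of G -> F} =>
    computes_threshold_scheme R #|inputs G| s c|%:R = Q%:R - #|bad|%:R :> R.
  apply/esym/eqP; rewrite subr_eq -natrD eqr_nat /Q -card_ffun.
  rewrite -(cardC (fun c : {ffun edge_of G -> F} =>
    computes_threshold_scheme R #|inputs G| s c)).
  by apply/eqP; congr (_ + _)%N; apply: eq_card => c; rewrite !inE.
(* It remains to see [#|bad| <= eta * Q]; after scaling by [#|F|.-1] this follows from [bad_le] and
   [N <= eta * #|F|.-1]. *)
rewrite mulrBl mul1r lerD2l lerN2 -(ler_pM2r q1_gt0).
move: bad_le; rewrite -(ler_nat R) 2!natrM => /le_trans; apply.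
rewrite [leRHS]mulrAC; apply: ler_wpM2r; first exact: ltW.
rewrite mulrC -ler_pdivrMr //; exact: ltW.
Qed.
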